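(* Let $(R,\mathfrak{m})$ be a commutative noetherian local ring. For an $R$-module $M$ the following are equivalent: (i) $M$ is totally separated. (ii) The canonical map $M\to\prod_{n\ge1}M/\mathfrak{m}^nM$ is a pure monomorphism. (iii) The pure-injective hull $N$ of $M$ is separated.
   Context: An $R$-module $A$ is separated if $\bigcap_{n\ge1}\mathfrak{m}^nA=0$. $M$ is totally separated if $X\otimes_RM$ is separated for every finitely generated $R$-module $X$. A pure submodule $A\subset B$ is pure-essential in $B$ if every submodule $X\subset B$ with $X\cap A=0$ and $(X\oplus A)/X$ pure in $B/X$ is zero. A pure-injective hull of $M$ is a pure-essential extension $M\subset N$ with $N$ pure-injective. *)

(* Defs.v *)
From HB Require Import structures.
From mathcomp Require Import all_boot all_algebra finmap.
From mathcomp Require Import boolp classical_sets.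
From mathcomp Require Import monalg.

Set Implicit Arguments.
Unset Strict Implicit.
Unset Printing Implicit Defensive.

Import GRing.Theory.
Local Open Scope ring_scope.
Local Open Scope classical_set_scope.

(* [submod_closed] predicates are boolean, but with the classical axioms of  *)
(* [boolp] every subset is decidable, so [submodule V] ranges over all the   *)
(* submodules of [V].                                                        *)
Record submodule (R : pzRingType) (V : lmodType R) := Submodule {
  submod_pred :> {pred V};
  submodP : submod_closed submod_pred }.

HB.instance Definition _ (R : pzRingType) (V : lmodType R) (S : submodule V) :=
  GRing.isSubmodClosed.Build R V (submod_pred S)
    (GRing.submod_closed_semi (submodP S)).

Notation ideal R := (@submodule R R^o).

Section SubmoduleType.
Variables (R : pzRingType) (V : lmodType R) (S : submodule V).

Definition submod_type := {x : V | x \in submod_pred S}.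

HB.instance Definition _ := SubChoice.on submod_type.
HB.instance Definition _ :=
  [SubChoice_isSubLmodule of submod_type by <:].

Definition submod_incl : submod_type -> V := val.

Lemma submod_incl_linear : linear submod_incl.
Proof. by []. Qed.

HB.instance Definition _ :=
  GRing.isLinear.Build R submod_type V *:%R submod_incl submod_incl_linear.

End SubmoduleType.

Section SubmoduleOperations.
Variables (R : pzRingType) (V : lmodType R).
Implicit Types (S T : submodule V) (G : set V).

Lemma fullm_closed : submod_closed (predT : {pred V}).
Proof. by []. Qed.
Definition fullm : submodule V := Submodule fullm_closed.

Definition addm_pred S T : {pred V} :=
  fun v => `[< exists s t, [/\ s \in S, t \in T & v = s + t] >].
Lemma addm_closed S T : submod_closed (addm_pred S T).
Proof.
split; first by apply/asboolP; exists 0, 0; rewrite !rpred0 addr0.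
move=> a u v /asboolP[s [t [sS tT ->]]] /asboolP[s' [t' [sS' tT' ->]]].
apply/asboolP; exists (a *: s + s'), (a *: t + t'); split.
- by rewrite rpredD // rpredZ.
- by rewrite rpredD // rpredZ.
- by rewrite scalerDr addrACA.
Qed.
Definition addm S T : submodule V := Submodule (addm_closed S T).

Definition spanm_pred G : {pred V} :=
  fun v => `[< forall S, (forall g, G g -> g \in S) -> v \in S >].
Lemma spanm_closed G : submod_closed (spanm_pred G).
Proof.
split; first by apply/asboolP => S _; rewrite rpred0.
move=> a u v /asboolP uG /asboolP vG; apply/asboolP => S GS.
by rewrite rpredD ?rpredZ ?uG ?vG.
Qed.
Definition spanm G : submodule V := Submodule (spanm_closed G).

Lemma mem_spanm G v : G v -> v \in spanm G.
Proof. by move=> Gv; apply/asboolP => S; exact. Qed.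

Lemma spanm_min G S :
  (forall g, G g -> g \in S) -> {subset spanm G <= S}.
Proof. by move=> GS v /asboolP; exact. Qed.

End SubmoduleOperations.

Arguments fullm {R} V.

Section ImageSubmodule.
Variables (R : pzRingType) (V W : lmodType R) (f : {linear V -> W}).

Definition imagem_pred (S : submodule V) : {pred W} :=
  fun w => `[< exists2 v, v \in S & f v = w >].
Lemma imagem_closed S : submod_closed (imagem_pred S).
Proof.
split; first by apply/asboolP; exists 0; rewrite ?rpred0 ?linear0.
move=> a _ _ /asboolP[u uS <-] /asboolP[v vS <-]; apply/asboolP.
by exists (a *: u + v); rewrite ?linearP // rpredD // rpredZ.
Qed.
Definition imagem S : submodule W := Submodule (imagem_closed S).

End ImageSubmodule.

Section QuotientModule.
Variables (R : pzRingType) (V : lmodType R) (S : submodule V).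
Local Open Scope quotient_scope.

Definition quotm := Quotient.quot (submod_pred S).

HB.instance Definition _ := GRing.Zmodule.on quotm.
HB.instance Definition _ := Quotient.on quotm.

Definition scaleq (a : R) (x : quotm) : quotm := \pi_quotm (a *: repr x).

Lemma eqquotmP (u v : V) : reflect (\pi_quotm u = \pi_quotm v) (u - v \in S).
Proof.
have -> : (u - v \in S) = (u == v %[mod quotm]).
  exact: (Quotient.idealrBE (submod_pred S) u v).
exact: (@eqP quotm).
Qed.

Lemma pi_scaleq (a : R) (v : V) : scaleq a (\pi_quotm v) = \pi_quotm (a *: v).
Proof.
apply/eqquotmP; rewrite -scalerBr rpredZ //; apply/eqquotmP.
by rewrite reprK.
Qed.

Lemma pi_addq (u v : V) : \pi_quotm (u + v) = \pi_quotm u + \pi_quotm v.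
Proof. exact: Quotient.pi_add. Qed.

Let piE (x : quotm) : exists v, x = \pi_quotm v.
Proof. by exists (repr x); rewrite reprK. Qed.

Fact scaleqA a b (x : quotm) : scaleq a (scaleq b x) = scaleq (a * b) x.
Proof. by have [v ->] := piE x; rewrite !pi_scaleq scalerA. Qed.
Fact scale1q : left_id 1 scaleq.
Proof. by move=> x; have [v ->] := piE x; rewrite pi_scaleq scale1r. Qed.
Fact scaleqDr : right_distributive scaleq +%R.
Proof.
move=> a x y; have [u ->] := piE x; have [v ->] := piE y.
by rewrite -pi_addq !pi_scaleq scalerDr pi_addq.
Qed.
Fact scaleqDl (x : quotm) : {morph scaleq^~ x : a b / a + b}.
Proof. by move=> a b; have [v ->] := piE x; rewrite !pi_scaleq scalerDl pi_addq. Qed.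

HB.instance Definition _ := GRing.Zmodule_isLmodule.Build R quotm
  scaleqA scale1q scaleqDr scaleqDl.

Definition quotm_proj (v : V) : quotm := \pi_quotm v.

Lemma quotm_proj_linear : linear quotm_proj.
Proof. by move=> a u v; rewrite /quotm_proj pi_addq -pi_scaleq. Qed.

HB.instance Definition _ :=
  GRing.isLinear.Build R V quotm *:%R quotm_proj quotm_proj_linear.

Lemma quotm_proj_eq (u v : V) :
  quotm_proj u = quotm_proj v <-> u - v \in S.
Proof. by split=> /eqquotmP. Qed.

Lemma quotm_projK (x : quotm) : quotm_proj (repr x) = x.
Proof. by rewrite /quotm_proj reprK. Qed.

Lemma quotm_proj_surj (x : quotm) : exists v, x = quotm_proj v.
Proof. by exists (repr x); rewrite quotm_projK. Qed.

End QuotientModule.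

Section ProductModule.
Variables (R : pzRingType) (I : Type) (V : I -> lmodType R).

Definition prodm := forall i, V i.

HB.instance Definition _ := Choice.on prodm.

Definition addp (f g : prodm) : prodm := fun i => f i + g i.
Definition oppp (f : prodm) : prodm := fun i => - f i.
Definition zerop : prodm := fun=> 0.
Definition scalep (a : R) (f : prodm) : prodm := fun i => a *: f i.

Fact addpA : associative addp.
Proof. by move=> f g h; apply: functional_extensionality_dep => i; exact: addrA. Qed.
Fact addpC : commutative addp.
Proof. by move=> f g; apply: functional_extensionality_dep => i; exact: addrC. Qed.
Fact add0p : left_id zerop addp.
Proof. by move=> f; apply: functional_extensionality_dep => i; exact: add0r. Qed.
Fact addNp : left_inverse zerop oppp addp.
Proof. by move=> f; apply: functional_extensionality_dep => i; exact: addNr. Qed.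

HB.instance Definition _ := GRing.isZmodule.Build prodm addpA addpC add0p addNp.

Fact scalepA a b f : scalep a (scalep b f) = scalep (a * b) f.
Proof. by apply: functional_extensionality_dep => i; exact: scalerA. Qed.
Fact scale1p : left_id 1 scalep.
Proof. by move=> f; apply: functional_extensionality_dep => i; exact: scale1r. Qed.
Fact scalepDr : right_distributive scalep +%R.
Proof. by move=> a f g; apply: functional_extensionality_dep => i; exact: scalerDr. Qed.
Fact scalepDl f : {morph scalep^~ f : a b / a + b}.
Proof. by move=> a b; apply: functional_extensionality_dep => i; exact: scalerDl. Qed.

HB.instance Definition _ := GRing.Zmodule_isLmodule.Build R prodm
  scalepA scale1p scalepDr scalepDl.

End ProductModule.

Section FreeModuleLift.
Variables (R : comNzRingType) (K : choiceType) (W : lmodType R) (h : K -> W).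

Definition malg_lift (g : {malg R[K]}) : W := \sum_(k <- msupp g) g@_k *: h k.

Lemma malg_liftEw (g : {malg R[K]}) (D : {fset K}) :
  (msupp g `<=` D)%fset -> malg_lift g = \sum_(k <- D) g@_k *: h k.
Proof.
move=> gD; rewrite /malg_lift (big_fset_incl _ gD) // => k kD kg.
by rewrite mcoeff_outdom // scale0r.
Qed.

Lemma malg_lift_linear : linear malg_lift.
Proof.
move=> a g g'; pose D := (msupp g `|` msupp g')%fset.
have gD : (msupp g `<=` D)%fset by exact: fsubsetUl.
have gD' : (msupp g' `<=` D)%fset by exact: fsubsetUr.
have sD : (msupp (a *: g + g') `<=` D)%fset.
  apply: fsubset_trans (msuppD_le _ _) _.
  by apply: fsetUSS (fsubset_refl _); exact: msuppZ_le.
rewrite (malg_liftEw gD) (malg_liftEw gD') (malg_liftEw sD).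
rewrite scaler_sumr -big_split /=; apply: eq_bigr => k _.
by rewrite mcoeffD mcoeffZ scalerDl scalerA.
Qed.

HB.instance Definition _ :=
  GRing.isLinear.Build R {malg R[K]} W *:%R malg_lift malg_lift_linear.

Lemma malg_liftU k : malg_lift << k >> = h k.
Proof.
rewrite (malg_liftEw (@msuppU_le _ _ k 1)) big_seq_fset1.
by rewrite mcoeffUU scale1r.
Qed.

End FreeModuleLift.

Section Tensor.
Variables (R : comNzRingType) (X M : lmodType R).

Definition tensor_rel : set {malg R[(X * M)%type]} := [set r |
  [\/ exists x x' y, r = << (x + x', y) >> - << (x, y) >> - << (x', y) >>,
      exists x y y', r = << (x, y + y') >> - << (x, y) >> - << (x, y') >>,
      exists a x y, r = << (a *: x, y) >> - a *: << (x, y) >> |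
      exists a x y, r = << (x, a *: y) >> - a *: << (x, y) >>]].

Definition tensor := quotm (spanm tensor_rel).

HB.instance Definition _ := GRing.Lmodule.on tensor.

Definition tmul (x : X) (y : M) : tensor :=
  quotm_proj (spanm tensor_rel) << (x, y) >>.

Lemma tmulDl x x' y : tmul (x + x') y = tmul x y + tmul x' y.
Proof.
rewrite /tmul -linearD; apply/quotm_proj_eq/mem_spanm.
by apply: Or41; exists x, x', y; rewrite opprD addrA.
Qed.

Lemma tmulDr x y y' : tmul x (y + y') = tmul x y + tmul x y'.
Proof.
rewrite /tmul -linearD; apply/quotm_proj_eq/mem_spanm.
by apply: Or42; exists x, y, y'; rewrite opprD addrA.
Qed.

Lemma tmulZl a x y : tmul (a *: x) y = a *: tmul x y.
Proof.
rewrite /tmul -linearZ; apply/quotm_proj_eq/mem_spanm.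
by apply: Or43; exists a, x, y.
Qed.

Lemma tmulZr a x y : tmul x (a *: y) = a *: tmul x y.
Proof.
rewrite /tmul -linearZ; apply/quotm_proj_eq/mem_spanm.
by apply: Or44; exists a, x, y.
Qed.

Section Lift.
Variables (P : lmodType R) (h : X -> M -> P).

(* Meaningful only for bilinear [h]; see [tensor_lift_tmul]. *)
Definition tensor_lift (t : tensor) : P :=
  malg_lift (fun xy => h xy.1 xy.2) (repr t).

Hypothesis hDl : forall x x' y, h (x + x') y = h x y + h x' y.
Hypothesis hDr : forall x y y', h x (y + y') = h x y + h x y'.
Hypothesis hZl : forall a x y, h (a *: x) y = a *: h x y.
Hypothesis hZr : forall a x y, h x (a *: y) = a *: h x y.

Local Notation L := (malg_lift (fun xy : X * M => h xy.1 xy.2)).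

Let kerL_closed : submod_closed ([pred r | L r == 0] : {pred _}).
Proof.
split=> [|a u v]; rewrite !inE ?linear0 // => /eqP u0 /eqP v0.
by rewrite linearP /= u0 v0 scaler0 addr0.
Qed.

Lemma tensor_lift_proj g : tensor_lift (quotm_proj (spanm tensor_rel) g) = L g.
Proof.
apply/eqP; rewrite -subr_eq0 -linearB /=.
apply: (spanm_min (S := Submodule kerL_closed)) => [r|]; last first.
  exact/quotm_proj_eq/quotm_projK.
rewrite inE; case=> [[x [x' [y ->]]]|[x [y [y' ->]]]|[a [x [y ->]]]|[a [x [y ->]]]].
- by rewrite !linearB /= !malg_liftU /= hDl addrAC addrK subrr.
- by rewrite !linearB /= !malg_liftU /= hDr addrAC addrK subrr.
- by rewrite linearB linearZ /= !malg_liftU /= hZl subrr.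
- by rewrite linearB linearZ /= !malg_liftU /= hZr subrr.
Qed.

Lemma tensor_lift_linear : linear tensor_lift.
Proof.
move=> a t t'; have [g ->] := quotm_proj_surj t.
have [g' ->] := quotm_proj_surj t'.
by rewrite -linearP !tensor_lift_proj linearP.
Qed.

Lemma tensor_lift_tmul x y : tensor_lift (tmul x y) = h x y.
Proof. by rewrite tensor_lift_proj malg_liftU. Qed.

End Lift.
End Tensor.

Section TensorMap.
Variables (R : comNzRingType) (X A B : lmodType R) (f : {linear A -> B}).

Definition tensor_map : tensor X A -> tensor X B :=
  tensor_lift (fun x a => tmul x (f a)).

Lemma tensor_map_linear : linear tensor_map.
Proof.
apply: tensor_lift_linear => *;
  by rewrite ?linearD ?linearZ (tmulDl, tmulDr, tmulZl, tmulZr).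
Qed.

HB.instance Definition _ := GRing.isLinear.Build R (tensor X A) (tensor X B)
  *:%R tensor_map tensor_map_linear.

Lemma tensor_map_tmul x a : tensor_map (tmul x a) = tmul x (f a).
Proof.
apply: tensor_lift_tmul => *;
  by rewrite ?linearD ?linearZ (tmulDl, tmulDr, tmulZl, tmulZr).
Qed.

End TensorMap.

Arguments tensor_map {R} X {A B} f t.

Section IdealsAndModules.
Variable R : comNzRingType.
Implicit Types (I : ideal R) (V : lmodType R).

Definition noetherian : Prop :=
  forall I, exists s : seq R^o, I =i spanm [set x | x \in s].

Definition fin_gen V : Prop :=
  exists s : seq V, forall v, v \in spanm [set x | x \in s].

Definition maximal_ideal I : Prop :=
  1 \notin I /\
  forall J : ideal R, {subset I <= J} -> 1 \notin J -> {subset J <= I}.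

Definition local_ring I : Prop :=
  maximal_ideal I /\ forall J : ideal R, maximal_ideal J -> J =i I.

Definition mulm V I (S : submodule V) : submodule V :=
  spanm [set v | exists a : R, exists x : V, [/\ a \in I, x \in S & v = a *: x]].

Definition ideal_pow I n : ideal R := iter n (mulm I) (fullm R^o).

Definition powm I n V : submodule V := mulm (ideal_pow I n) (fullm V).

End IdealsAndModules.

Section Purity.
Variable R : comNzRingType.
Implicit Types A B N : lmodType R.

(* Taking [X = R] shows that such an [f] is injective, see [pure_mono_inj].  *)
Definition pure_mono A B (f : {linear A -> B}) : Prop :=
  forall X : lmodType R, injective (tensor_map X f).

Lemma pure_mono_inj A B (f : {linear A -> B}) : pure_mono f -> injective f.
Proof.
move=> /(_ R^o) f_inj a a' faa'.
have /f_inj : tensor_map R^o f (tmul (1 : R^o) a) = tensor_map R^o f (tmul (1 : R^o) a').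
  by rewrite !tensor_map_tmul faa'.
move/(congr1 (tensor_lift (fun (r : R^o) (x : A) => (r : R) *: x))).
rewrite !tensor_lift_tmul ?scale1r // => *;
  by rewrite ?scalerDl ?scalerDr ?scalerA // mulrC.
Qed.

Definition pure_submodule B (A : submodule B) : Prop :=
  pure_mono (@submod_incl R B A).

Definition pure_essential B (A : submodule B) : Prop :=
  pure_submodule A /\
  forall X : submodule B,
    (forall x, x \in X -> x \in A -> x = 0) ->
    pure_submodule (imagem (@quotm_proj R B X) (addm X A)) ->
    forall x, x \in X -> x = 0.

Definition pure_injective N : Prop :=
  forall A B (f : {linear A -> B}), pure_mono f ->
  forall g : {linear A -> N}, exists h : {linear B -> N}, forall a, h (f a) = g a.

Definition pure_injective_hull A N (i : {linear A -> N}) : Prop :=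
  [/\ injective i, pure_essential (imagem i (fullm A)) & pure_injective N].

End Purity.

Section Separatedness.
Variables (R : comNzRingType) (m : ideal R).

Definition separated (A : lmodType R) : Prop :=
  forall x : A, (forall n, (1 <= n)%N -> x \in powm m n A) -> x = 0.

Definition totally_separated (M : lmodType R) : Prop :=
  forall X : lmodType R, fin_gen X -> separated (tensor X M).

(* The factor indexed by [k] is [M / m^(k+1) M], so that the exponents run   *)
(* over the integers [n >= 1].                                               *)
Definition adic_prod (M : lmodType R) : lmodType R :=
  prodm (fun k : nat => quotm (powm m k.+1 M)).

Definition adic_map (M : lmodType R) : M -> adic_prod M :=
  fun x k => quotm_proj (powm m k.+1 M) x.

Lemma adic_map_linear (M : lmodType R) : linear (@adic_map M).
Proof.
move=> a x y; apply: functional_extensionality_dep => k.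
exact: (linearP (quotm_proj (powm m k.+1 M))).
Qed.

HB.instance Definition _ (M : lmodType R) :=
  GRing.isLinear.Build R M (adic_prod M) *:%R (@adic_map M) (@adic_map_linear M).

End Separatedness.

(* Main.v *)
From HB Require Import structures.
Require Import Defs.
From mathcomp Require Import all_boot all_algebra finmap.
From mathcomp Require Import boolp classical_sets monalg.

Set Implicit Arguments.
Unset Strict Implicit.
Unset Printing Implicit Defensive.

Import GRing.Theory.
Local Open Scope ring_scope.

(** Everything is tested on a finitely generated module X, because an element
    of X (x) A that dies in X (x) B already comes from, and dies over, a
    finitely generated submodule of X ([pure_mono_fg]).  As R is noetherian, X
    has a presentation with generators x_i and a finite matrix a of relations,
    and sum_i x_i (x) n_i vanishes exactly when the linear system
    n_i = sum_j a_ji y_j has a solution y ([fin_presentation]).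

    Totally separated versus pure in the adic product.  The kernel of
    X (x) M -> X (x) M/m^n M is m^n (X (x) M) ([tensor_quot_powm]).  So an
    element that dies in X (x) prod M/m^n M lies in every m^n (X (x) M).
    Conversely, if t lies in all of these, then its image vanishes in every
    X (x) M/m^n M; each of these facts gives a solution of the system above.
    The solutions are the coordinates of one solution over the product, so the
    image of t in X (x) prod M/m^n M is 0.

    The hull N of a totally separated M is separated.  Let X be the
    intersection of the m^n N.  An element of Z (x) M that dies in
    Z (x) N/X has its image in m^n (Z (x) N) for all n, and it is itself in
    m^n (Z (x) M) since M is pure in N ([pure_powm]); so it is 0.  Thus
    M -> N/X is pure, and pure-essentiality forces X = 0.

    If the hull N is separated, then M is totally separated.  It suffices to
    show that N is ([pure_totally_separated]).  If sum_i x_i (x) n_i is in all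
    m^n (X (x) N), the system is solvable modulo every m^n N.  The sequence of
    these approximate solutions solves it, modulo every m^n at once, in the
    reduced power of N (sequences modulo finitely supported ones).  The
    diagonal of N in its reduced power is pure ([pure_diag]), so that
    pure-injectivity gives a retraction onto N; it carries the solution to N,
    where it is exact because N is separated. *)

(** * Submodules, sums of tensors and right exactness *)

Section LinearAlgebra.
Variable R : comNzRingType.

Section SubmoduleOfProp.
Variables (V : lmodType R) (P : V -> Prop).
Hypothesis P0 : P 0.
Hypothesis PD : forall a u v, P u -> P v -> P (a *: u + v).

Fact submodule_of_closed : submod_closed ((fun v => `[< P v >]) : {pred V}).
Proof.
by split=> [|a u v /asboolP Pu /asboolP Pv]; apply/asboolP; [|exact: PD].
Qed.
Definition submodule_of : submodule V := Submodule submodule_of_closed.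

Lemma mem_submodule_of v : v \in submodule_of <-> P v.
Proof. by split=> [/asboolP|Pv]; last exact/asboolP. Qed.
End SubmoduleOfProp.

Definition linear_of (V W : lmodType R) (f : V -> W) (fL : linear f) :
  {linear V -> W} := HB.pack f (GRing.isLinear.Build R V W *:%R f fL).

Lemma span_seqP (V : lmodType R) (s : seq V) v :
  v \in spanm [set x | x \in s] ->
  exists c : 'I_(size s) -> R, v = \sum_i c i *: tnth (in_tuple s) i.
Proof.
pose P v := exists c : 'I_(size s) -> R, v = \sum_i c i *: tnth (in_tuple s) i.
have P0 : P 0 by exists (fun=> 0); rewrite big1 // => i _; rewrite scale0r.
have PD a u w : P u -> P w -> P (a *: u + w).
  move=> [c ->] [d ->]; exists (fun i => a * c i + d i).
  rewrite scaler_sumr -big_split; apply: eq_bigr => i _ /=.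
  by rewrite scalerDl scalerA.
move=> vs; apply/(mem_submodule_of P0 PD); apply: spanm_min vs => g /= gs.
apply/(mem_submodule_of P0 PD).
have /tnthP[j ->] : g \in in_tuple s by [].
exists (fun i => (i == j)%:R); rewrite (bigD1 j) //= eqxx scale1r.
by rewrite big1 ?addr0 // => i /negPf->; rewrite scale0r.
Qed.

Lemma span_seq_fin_gen (V : lmodType R) (s : seq V) :
  fin_gen (submod_type (spanm [set x | x \in s])).
Proof.
set S := spanm _; exists (pmap insub s : seq (submod_type S)) => v.
have sS : {in s, forall x, x \in S} by move=> x xs; apply: mem_spanm.
set s' := pmap insub s.
have : val v \in imagem (@submod_incl _ _ S) (spanm [set x | x \in s']).
  apply: (spanm_min (G := [set x | x \in s])); last exact: valP v.
  move=> g /= gs; apply/asboolP; exists (Sub g (sS g gs)); last exact: SubK.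
  by apply: mem_spanm; rewrite /= mem_pmap_sub SubK.
by case/asboolP => w wS /val_inj <-.
Qed.

Lemma quotm_proj0 (V : lmodType R) (S : submodule V) v :
  quotm_proj S v = 0 <-> v \in S.
Proof. by rewrite -(linear0 (quotm_proj S)) quotm_proj_eq subr0. Qed.

Lemma quotm_surj (V : lmodType R) (S : submodule V) (x : quotm S) :
  exists v, quotm_proj S v = x.
Proof. by have [v ->] := quotm_proj_surj x; exists v. Qed.

Section Evaluation.
Variables (I : Type) (V : I -> lmodType R) (i : I).

Lemma prodm_eval_linear : linear (fun f : prodm V => f i).
Proof. by []. Qed.
Definition prodm_eval := linear_of prodm_eval_linear.

Lemma prodm_sumE J (r : seq J) (F : J -> prodm V) :
  (\sum_(j <- r) F j : prodm V) i = \sum_(j <- r) F j i.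
Proof. exact: (linear_sum prodm_eval r predT F). Qed.
End Evaluation.

Section TensorSums.
Variables X M : lmodType R.

Lemma tmul_linearl (y : M) : linear (fun x : X => tmul x y).
Proof. by move=> a u v; rewrite tmulDl tmulZl. Qed.
Lemma tmul_linearr (x : X) : linear (fun y : M => tmul x y).
Proof. by move=> a u v; rewrite tmulDr tmulZr. Qed.
Lemma tmul0l (y : M) : tmul (0 : X) y = 0.
Proof. exact: (linear0 (linear_of (tmul_linearl y))). Qed.
Lemma tmul0r (x : X) : tmul x (0 : M) = 0.
Proof. exact: (linear0 (linear_of (tmul_linearr x))). Qed.
Lemma tmulBr (x : X) (y z : M) : tmul x (y - z) = tmul x y - tmul x z.
Proof. exact: (linearB (linear_of (tmul_linearr x))). Qed.
Lemma tmulBl (x z : X) (y : M) : tmul (x - z) y = tmul x y - tmul z y.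
Proof. exact: (linearB (linear_of (tmul_linearl y))). Qed.
Lemma tmul_suml I (r : seq I) (F : I -> X) (y : M) :
  tmul (\sum_(i <- r) F i) y = \sum_(i <- r) tmul (F i) y.
Proof. exact: (linear_sum (linear_of (tmul_linearl y))). Qed.
Lemma tmul_sumr I (r : seq I) (F : I -> M) (x : X) :
  tmul x (\sum_(i <- r) F i) = \sum_(i <- r) tmul x (F i).
Proof. exact: (linear_sum (linear_of (tmul_linearr x))). Qed.

Lemma tensor_sumP (t : tensor X M) :
  exists s : seq (X * M), t = \sum_(u <- s) tmul u.1 u.2.
Proof.
have [g ->] := quotm_proj_surj t.
rewrite [g in quotm_proj _ g]monalgE linear_sum /=.
exists [seq (g@_k *: k.1, k.2) | k <- msupp g]; rewrite big_map.
apply: eq_bigr => -[x y] _ /=; rewrite tmulZl /tmul -linearZ /=.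
congr quotm_proj; apply/malgP => k.
by rewrite mcoeffZ !mcoeffU mulrnAr mulr1.
Qed.

Definition bilinear_fun (P : lmodType R) (h : X -> M -> P) :=
  [/\ forall x x' y, h (x + x') y = h x y + h x' y,
      forall x y y', h x (y + y') = h x y + h x y',
      forall a x y, h (a *: x) y = a *: h x y &
      forall a x y, h x (a *: y) = a *: h x y].

(** The linear map induced by a bilinear one, packaged so that a single
    hypothesis replaces the four that [tensor_lift] takes. *)
Lemma bilinear_lift (P : lmodType R) (h : X -> M -> P) :
  bilinear_fun h ->
  exists L : {linear tensor X M -> P}, forall x y, L (tmul x y) = h x y.
Proof.
case=> hDl hDr hZl hZr.
exists (linear_of (tensor_lift_linear hDl hDr hZl hZr)) => x y.
exact: tensor_lift_tmul.
Qed.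

Lemma bilinear_sum0 (P : lmodType R) (h : X -> M -> P) I (r : seq I) x y :
  bilinear_fun h ->
  \sum_(i <- r) tmul (x i) (y i) = 0 -> \sum_(i <- r) h (x i) (y i) = 0.
Proof.
move=> /bilinear_lift[L LE] sum0; under eq_bigr do rewrite -LE.
by rewrite -linear_sum sum0 linear0.
Qed.

End TensorSums.

Lemma bilinear_tmul (X M : lmodType R) : bilinear_fun (@tmul R X M).
Proof. by split=> *; rewrite (tmulDl, tmulDr, tmulZl, tmulZr). Qed.

Lemma bilinear_comp (X M X' M' P : lmodType R) (h : X -> M -> P)
    (p : {linear X' -> X}) (q : {linear M' -> M}) :
  bilinear_fun h -> bilinear_fun (fun x y => h (p x) (q y)).
Proof.
case=> hDl hDr hZl hZr; split=> *; rewrite ?linearD ?linearZ /=;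
  by rewrite (hDl, hDr, hZl, hZr).
Qed.

(** Right exactness of the tensor product in both variables at once: T contains
    the tensors with one factor in the kernel of p or of q, so that
    (p x, q y) |-> x (x) y is a well defined bilinear map to (X (x) M) / T.
    Taking p or q to be the identity gives exactness in one variable. *)
Lemma tensor_right_exact (X M X' M' : lmodType R)
    (p : {linear X -> X'}) (q : {linear M -> M'})
    (T : submodule (tensor X M)) I (r : seq I) x y :
  (forall x', exists x, p x = x') -> (forall y', exists y, q y = y') ->
  (forall x y, p x = 0 -> tmul x y \in T) ->
  (forall x y, q y = 0 -> tmul x y \in T) ->
  \sum_(i <- r) tmul (p (x i)) (q (y i)) = 0 ->
  \sum_(i <- r) tmul (x i) (y i) \in T.
Proof.
move=> /choice[sp spK] /choice[sq sqK] Tp Tq sum0.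
pose h x' y' := quotm_proj T (tmul (sp x') (sq y')).
have hE u v : h (p u) (q v) = quotm_proj T (tmul u v).
  apply/quotm_proj_eq.
  rewrite -(subrKA (tmul u (sq (q v)))) -tmulBl -tmulBr rpredD //.
  - by apply: Tp; rewrite linearB /= spK subrr.
  - by apply: Tq; rewrite linearB /= sqK subrr.
have hbil : bilinear_fun h.
  split.
  - move=> u u' v; rewrite -(spK u) -(spK u') -(sqK v) -linearD !hE.
    by rewrite tmulDl linearD.
  - move=> u v v'; rewrite -(spK u) -(sqK v) -(sqK v') -linearD !hE.
    by rewrite tmulDr linearD.
  - move=> a u v; rewrite -(spK u) -(sqK v) -linearZ !hE.
    by rewrite tmulZl linearZ.
  - move=> a u v; rewrite -(spK u) -(sqK v) -linearZ !hE.
    by rewrite tmulZr linearZ.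
have := bilinear_sum0 hbil sum0.
under eq_bigr do rewrite hE.
by rewrite -linear_sum => /quotm_proj0.
Qed.

Lemma tensor_map_sum (X A B : lmodType R) (f : {linear A -> B})
    I (r : seq I) (x : I -> X) (y : I -> A) :
  tensor_map X f (\sum_(i <- r) tmul (x i) (y i)) =
  \sum_(i <- r) tmul (x i) (f (y i)).
Proof.
by rewrite linear_sum; apply: eq_bigr => i _; rewrite /= tensor_map_tmul.
Qed.

Lemma tensor_map_comp (X A B C : lmodType R) (f : {linear A -> B})
    (g : {linear B -> C}) (h : {linear A -> C}) :
  (forall a, g (f a) = h a) ->
  forall t, tensor_map X g (tensor_map X f t) = tensor_map X h t.
Proof.
move=> gfE t; have [s ->] := tensor_sumP t; rewrite !tensor_map_sum.
by apply: eq_bigr => u _; rewrite gfE.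
Qed.

Lemma tensor_map_id (X A : lmodType R) (f : {linear A -> A}) :
  (forall a, f a = a) -> forall t, tensor_map X f t = t.
Proof.
move=> fE t; have [s ->] := tensor_sumP t; rewrite tensor_map_sum.
by apply: eq_bigr => u _; rewrite fE.
Qed.

(** * Purity is tested on finitely generated modules *)

(** A vanishing sum of tensors is a combination of finitely many defining
    relations of X (x) B, and only finitely many elements of X occur in them:
    the sum vanishes over any submodule that contains these.  The function s0
    reads elements of X in the submodule X0. *)
Lemma tensor_sum0_fg (X B : lmodType R) (s : seq (X * B)) :
  \sum_(u <- s) tmul u.1 u.2 = 0 ->
  exists (X0 : lmodType R) (j : {linear X0 -> X}) (s0 : X -> X0),
    [/\ fin_gen X0, forall u, u \in s -> j (s0 u.1) = u.1 &
        \sum_(u <- s) tmul (s0 u.1) u.2 = 0].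
Proof.
move=> sum0.
pose gen (l : seq X) := spanm [set x | x \in l].
pose res l x : submod_type (gen l) := insubd 0 x.
have resK l x : x \in gen l -> sval (res l x) = x.
  by move=> xl; exact: (@insubdK _ _ (submod_type (gen l)) 0 x xl).
(* L l reads a formal sum of pairs in (gen l) (x) B; pairs whose first        *)
(* component lies outside gen l are sent to 0 by the default value of res.    *)
pose L l := malg_lift (fun u : X * B => tmul (res l u.1) u.2).
(* The formal sums that L l kills for all large enough l form a submodule,    *)
(* which contains the defining relations.                                     *)
pose P g := exists l0 : seq X, forall l : seq X, {subset l0 <= l} -> L l g = 0.
have P0 : P 0 by exists [::] => l _; rewrite /L linear0.
have PD a u v : P u -> P v -> P (a *: u + v).
  move=> [l lP] [l' lP']; exists (l ++ l') => k sk.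
  rewrite /L linearP /= -/(L k) lP ?lP' ?scaler0 ?addr0 // => x xl;
    by apply: sk; rewrite mem_cat xl ?orbT.
have /mem_submodule_of[l0 l0P] :
    \sum_(u <- s) << u >> \in submodule_of P0 PD.
  have : \sum_(u <- s) (<< u >> : {malg R[(X * B)%type]})
      \in spanm (@tensor_rel R X B).
    rewrite -[X in X \in _]subr0; apply/quotm_proj_eq.
    rewrite linear_sum linear0 -[RHS]sum0; apply: eq_bigr => -[x y] _ //.
  apply: spanm_min => g; case.
  - move=> [x [x' [y ->]]]; apply/mem_submodule_of.
    exists [:: x; x'] => l sl.
    have xl : x \in gen l by apply/mem_spanm/sl; rewrite !inE eqxx.
    have xl' : x' \in gen l by apply/mem_spanm/sl; rewrite !inE eqxx orbT.
    rewrite /L !linearB /= !malg_liftU /= -!tmulBl.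
    rewrite (_ : _ - _ = 0) ?tmul0l //; apply: val_inj => /=.
    by rewrite !resK ?rpredD // addrAC addrK subrr.
  - move=> [x [y [y' ->]]]; apply/mem_submodule_of; exists [::] => l _.
    by rewrite /L !linearB /= !malg_liftU /= tmulDr addrAC addrK subrr.
  - move=> [a [x [y ->]]]; apply/mem_submodule_of.
    exists [:: x] => l sl.
    have xl : x \in gen l by apply/mem_spanm/sl; rewrite !inE eqxx.
    rewrite /L linearB linearZ /= !malg_liftU /= -tmulZl -tmulBl.
    rewrite (_ : _ - _ = 0) ?tmul0l //; apply: val_inj => /=.
    by rewrite !resK ?rpredZ // subrr.
  - move=> [a [x [y ->]]]; apply/mem_submodule_of; exists [::] => l _.
    by rewrite /L linearB linearZ /= !malg_liftU /= tmulZr subrr.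
pose l := l0 ++ map fst s.
exists (submod_type (gen l)), (@submod_incl _ _ (gen l)), (res l); split.
- exact: span_seq_fin_gen.
- move=> u us; apply: resK; apply: mem_spanm => /=.
  by rewrite mem_cat map_f ?orbT.
- have := l0P l; rewrite /L linear_sum /= => e; rewrite -[RHS]e.
    by apply: eq_bigr => u _; rewrite malg_liftU.
  by move=> x xl; rewrite mem_cat xl.
Qed.

Lemma pure_mono_fg (A B : lmodType R) (f : {linear A -> B}) :
  (forall X, fin_gen X -> forall t, tensor_map X f t = 0 -> t = 0) ->
  pure_mono f.
Proof.
move=> f_inj X t t' /eqP; rewrite -subr_eq0 -linearB /= => /eqP ft0.
apply/eqP; rewrite -subr_eq0; apply/eqP; move: (t - t') ft0 => {t t'} t.
have [s ->] := tensor_sumP t; rewrite tensor_map_sum => ft0.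
have := @tensor_sum0_fg X B [seq (u.1, f u.2) | u <- s].
rewrite big_map => /(_ ft0)[X0 [j [s0 [X0fg s0K]]]]; rewrite big_map /= => f0.
have /f_inj -/(_ X0fg) sum0 :
    tensor_map X0 f (\sum_(u <- s) tmul (s0 u.1) u.2) = 0.
  by rewrite tensor_map_sum.
have := bilinear_sum0 (bilinear_comp j idfun (@bilinear_tmul X A)) sum0 => /=.
move=> e; rewrite -[RHS]e; rewrite big_seq [RHS]big_seq; apply: eq_bigr => u us.
by rewrite (s0K (u.1, f u.2)) //; apply/mapP; exists u.
Qed.
End LinearAlgebra.

(** * Finite presentations over a noetherian ring *)

Section Presentation.
Variable R : comNzRingType.
Hypothesis R_noetherian : noetherian R.

(** Induction on k: the first coordinates of the elements of S form an ideal,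
    and those with first coordinate 0 form a submodule of a free module of
    smaller rank.  Generators of the former, lifted to S, and generators of
    the latter together generate S. *)
Lemma noetherian_rV k (S : submodule 'rV[R]_k) :
  exists l (a : 'M[R]_(l, k)),
    (forall j, row j a \in S) /\
    (forall v, v \in S -> exists c : 'rV_l, v = c *m a).
Proof.
elim: k S => [|k IHk] S.
  by exists 0, 0; split=> [[]//|v _]; exists 0; rewrite [v]thinmx0 [RHS]thinmx0.
rewrite -[k.+1]/(1 + k)%N in S *.
have fstL : linear (fun v : 'rV[R]_(1 + k) => v 0 (lshift k 0) : R^o).
  by move=> a u v; rewrite !mxE.
have tailL : linear (fun w : 'rV[R]_k => row_mx 0 w : 'rV_(1 + k)).
  by move=> a u v; rewrite scale_row_mx add_row_mx scaler0 addr0.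
have [s sE] := R_noetherian (imagem (linear_of fstL) S).
have /choice[w wP] : forall i, exists w : 'rV[R]_(1 + k),
    w \in S /\ w 0 (lshift k 0) = tnth (in_tuple s) i.
  move=> i; have : tnth (in_tuple s) i \in imagem (linear_of fstL) S.
    by rewrite sE; apply: mem_spanm; exact: mem_tnth.
  by case/asboolP => w wS <-; exists w.
pose P (v : 'rV[R]_k) := linear_of tailL v \in S.
have P0 : P 0 by rewrite /P linear0 rpred0.
have PD a u v : P u -> P v -> P (a *: u + v).
  by move=> Pu Pv; rewrite /P linearP rpredD ?rpredZ.
have [l [a [aS aP]]] := IHk (submodule_of P0 PD).
pose W := \matrix_(i, j) w i 0 j.
have rW i : row i W = w i by apply/rowP => j; rewrite !mxE.
exists (size s + l)%N, (col_mx W (row_mx (0 : 'cV_l) a)); split.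
  move=> j; rewrite -(splitK j); case: (split j) => i /=.
    by rewrite rowKu rW; case: (wP i).
  rewrite rowKd (@row_row_mx _ l 1 k i 0 a) row0.
  exact/(mem_submodule_of P0 PD)/aS.
move=> v vS.
have : v 0 (lshift k 0) \in imagem (linear_of fstL) S.
  by apply/asboolP; exists v.
rewrite sE => /span_seqP[c cE].
pose d := \row_i c i; pose v' := v - d *m W.
have v'S : v' \in S.
  rewrite rpredB // mulmx_sum_row rpred_sum // => i _.
  by rewrite rW rpredZ //; case: (wP i).
have v'E : v' = row_mx 0 (rsubmx v').
  rewrite -[LHS](hsubmxK v'); congr row_mx.
  apply/rowP => i; rewrite ord1 !mxE.
  apply/eqP; rewrite subr_eq0 cE; apply/eqP; apply: eq_bigr => j _.
  by rewrite !mxE; case: (wP j) => _ ->.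
have /aP[c' c'E] : rsubmx v' \in submodule_of P0 PD.
  by apply/(mem_submodule_of P0 PD); rewrite /P /= -v'E.
exists (row_mx d c'); rewrite mul_row_col mul_mx_row mulmx0 -c'E -v'E.
by rewrite addrC subrK.
Qed.

(** The rows of a generate the relations between the generators xs.  The last
    clause is the equational criterion for vanishing: it expresses the
    isomorphism between X (x) N and the cokernel of a^T on N^k. *)
Lemma fin_presentation (X : lmodType R) : fin_gen X ->
  exists k (xs : 'I_k -> X) l (a : 'M[R]_(l, k)),
    [/\ forall x, exists c : 'I_k -> R, x = \sum_i c i *: xs i,
        forall j, \sum_i a j i *: xs i = 0 &
        forall (N : lmodType R) (n : 'I_k -> N), \sum_i tmul (xs i) (n i) = 0 ->
          exists y : 'I_l -> N, forall i, n i = \sum_j a j i *: y j].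
Proof.
case=> s sX; pose xs := tnth (in_tuple s).
have xsX x : exists c : 'I_(size s) -> R, x = \sum_i c i *: xs i.
  exact: span_seqP.
have combL : linear (fun c : 'rV[R]_(size s) => \sum_i c 0 i *: xs i).
  move=> a u v; rewrite scaler_sumr -big_split; apply: eq_bigr => i _.
  by rewrite !mxE scalerDl scalerA.
pose P (c : 'rV[R]_(size s)) := linear_of combL c = 0.
have P0 : P 0 by rewrite /P linear0.
have PD a u v : P u -> P v -> P (a *: u + v).
  by rewrite /P linearP => -> ->; rewrite scaler0 addr0.
have [l [a [aS aP]]] := noetherian_rV (submodule_of P0 PD).
exists (size s), xs, l, a; split=> //.
  move=> j; have /mem_submodule_of := aS j; rewrite /P /= => e.
  by rewrite -[RHS]e; apply: eq_bigr => i _; rewrite mxE.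
move=> N n sum0.
pose E := prodm (fun _ : 'I_(size s) => N).
pose Q (f : E) := exists y : 'I_l -> N, forall i, f i = \sum_j a j i *: y j.
have Q0 : Q 0 by exists (fun=> 0) => i; rewrite big1 // => j _; rewrite scaler0.
have QD b f g : Q f -> Q g -> Q (b *: f + g).
  case=> y yE [z zE]; exists (fun j => b *: y j + z j) => i.
  have -> : (b *: f + g) i = b *: f i + g i by [].
  rewrite yE zE scaler_sumr -big_split.
  by apply: eq_bigr => j _; rewrite scalerDr !scalerA mulrC.
pose SQ := submodule_of Q0 QD.
(* The inverse isomorphism X (x) N -> N^k / SQ sends x (x) y to the class of  *)
(* (c_i y)_i, for any coordinates c of x; their choice does not matter.       *)
have [co coE] := choice xsX.
pose mk (c : 'I_(size s) -> R) (y : N) : E := fun i => c i *: y.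
pose h x y := quotm_proj SQ (mk (co x) y).
have hE x y c : x = \sum_i c i *: xs i -> h x y = quotm_proj SQ (mk c y).
  move=> xE; apply/quotm_proj_eq/mem_submodule_of.
  have /aP[d dE] : \row_i (co x i - c i) \in submodule_of P0 PD.
    apply/mem_submodule_of; rewrite /P /=.
    under eq_bigr do rewrite mxE scalerBl.
    by rewrite sumrB -coE -xE subrr.
  exists (fun j => d 0 j *: y) => i.
  have -> : (mk (co x) y - mk c y) i = (co x i - c i) *: y by rewrite scalerBl.
  have /rowP/(_ i) := dE; rewrite !mxE => ->.
  by rewrite scaler_suml; apply: eq_bigr => j _; rewrite scalerA mulrC.
have hbil : bilinear_fun h.
  split.
  - move=> x x' y; rewrite (hE _ _ (fun i => co x i + co x' i)).
      rewrite -linearD; congr quotm_proj.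
      by apply: functional_extensionality_dep => i; exact: scalerDl.
    by under eq_bigr do rewrite scalerDl; rewrite big_split -!coE.
  - move=> x y y'; rewrite -linearD; congr quotm_proj.
    by apply: functional_extensionality_dep => i; exact: scalerDr.
  - move=> b x y; rewrite (hE _ _ (fun i => b * co x i)).
      rewrite -linearZ; congr quotm_proj.
      by apply: functional_extensionality_dep => i; rewrite [RHS]scalerA.
    by under eq_bigr do rewrite -scalerA; rewrite -scaler_sumr -coE.
  - move=> b x y; rewrite -linearZ; congr quotm_proj.
    apply: functional_extensionality_dep => i.
    by rewrite [RHS]scalerA mulrC -scalerA.
have := bilinear_sum0 hbil sum0.
under eq_bigr => i _.
  rewrite (hE _ _ (fun j => (j == i)%:R)); last first.
    rewrite (bigD1 i) //= eqxx scale1r big1 ?addr0 // => j /negPf->.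
    by rewrite scale0r.
  over.
rewrite -linear_sum -(linear0 (quotm_proj SQ)) => /quotm_proj_eq.
rewrite subr0 => /mem_submodule_of[y yE]; exists y => i; rewrite -yE.
rewrite prodm_sumE (bigD1 i) //= /mk eqxx scale1r.
by rewrite big1 ?addr0 // => j /negPf; rewrite eq_sym => ->; rewrite scale0r.
Qed.

End Presentation.

(** * The adic filtration of a tensor product *)

Section AdicFiltration.
Variables (R : comNzRingType) (m : ideal R).

Lemma scale_powm (V : lmodType R) n (a : R) (x : V) :
  a \in ideal_pow m n -> a *: x \in powm m n V.
Proof. by move=> aI; apply: mem_spanm => /=; exists a, x. Qed.

Lemma powm_min (V : lmodType R) n (S : submodule V) :
  (forall (a : R) (x : V), a \in ideal_pow m n -> a *: x \in S) ->
  {subset powm m n V <= S}.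
Proof. by move=> aS; apply: spanm_min => _ [a [x [aI _ ->]]]; apply: aS. Qed.

Lemma powm_map (V W : lmodType R) (f : {linear V -> W}) n x :
  x \in powm m n V -> f x \in powm m n W.
Proof.
pose P x := f x \in powm m n W.
have P0 : P 0 by rewrite /P linear0 rpred0.
have PD a u v : P u -> P v -> P (a *: u + v).
  by move=> Pu Pv; rewrite /P linearP rpredD ?rpredZ.
move=> xV; apply/(mem_submodule_of P0 PD); apply: powm_min xV => a v aI.
by apply/mem_submodule_of; rewrite /P linearZ; exact: scale_powm.
Qed.

Lemma powm_ann (V : lmodType R) n :
  (forall (a : R) (x : V), a \in ideal_pow m n -> a *: x = 0) ->
  forall x, x \in powm m n V -> x = 0.
Proof.
move=> ann x; pose P (x : V) := x = 0.
have PD a u v : P u -> P v -> P (a *: u + v).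
  by rewrite /P => -> ->; rewrite scaler0 addr0.
move=> xV; apply/(mem_submodule_of (erefl : P 0) PD).
by apply: powm_min xV => a v aI; apply/mem_submodule_of; exact: ann.
Qed.

Lemma ideal_pow_le n n' : (n <= n')%N ->
  {subset ideal_pow m n' <= ideal_pow m n}.
Proof.
move/subnK <-; elim: (n' - n)%N => [|d IHd] // a aI.
apply: IHd; apply: spanm_min aI => _ [b [x [_ xI ->]]].
exact: rpredZ.
Qed.

Lemma powm_le (V : lmodType R) n n' : (n <= n')%N ->
  {subset powm m n' V <= powm m n V}.
Proof.
by move=> le; apply: powm_min => a x /(ideal_pow_le le); exact: scale_powm.
Qed.

Lemma powm_quot_ann (V : lmodType R) n (a : R) (x : quotm (powm m n V)) :
  a \in ideal_pow m n -> a *: x = 0.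
Proof.
have [v ->] := quotm_proj_surj x => aI; rewrite -linearZ.
by apply/quotm_proj0; exact: scale_powm.
Qed.

Lemma powm_tensor_annl (X M : lmodType R) n (t : tensor X M) :
  (forall (a : R) (x : X), a \in ideal_pow m n -> a *: x = 0) ->
  t \in powm m n (tensor X M) -> t = 0.
Proof.
move=> ann; apply: powm_ann => a {}t aI; have [s ->] := tensor_sumP t.
rewrite scaler_sumr big1 // => u _.
by rewrite -tmulZl ann // tmul0l.
Qed.

Lemma powm_tensor_annr (X M : lmodType R) n (t : tensor X M) :
  (forall (a : R) (x : M), a \in ideal_pow m n -> a *: x = 0) ->
  t \in powm m n (tensor X M) -> t = 0.
Proof.
move=> ann; apply: powm_ann => a {}t aI; have [s ->] := tensor_sumP t.
rewrite scaler_sumr big1 // => u _.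
by rewrite -tmulZr ann // tmul0r.
Qed.

(** X (x) M/m^n M is the quotient of X (x) M by the tensors x (x) a y with a in
    m^n, and these generate m^n (X (x) M). *)
Lemma tensor_quot_powm (X M : lmodType R) n (t : tensor X M) :
  tensor_map X (quotm_proj (powm m n M)) t = 0 <->
  t \in powm m n (tensor X M).
Proof.
split=> [|tn]; last first.
  apply: powm_tensor_annr (powm_map _ tn) => a x; exact: powm_quot_ann.
have [s ->] := tensor_sumP t; rewrite tensor_map_sum.
apply: (tensor_right_exact (p := idfun)) => [x|y|x y x0|x y /quotm_proj0 yn].
- by exists x.
- exact: quotm_surj.
- by rewrite (x0 : x = 0) tmul0l rpred0.
- exact: (powm_map (linear_of (@tmul_linearr R X M x)) yn).
Qed.

(** (X/m^n X) (x) A is X (x) A modulo m^n (X (x) A), and similarly for B, so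
    the claim is the injectivity of f tensored with X/m^n X. *)
Lemma pure_powm (A B : lmodType R) (f : {linear A -> B}) (X : lmodType R) n t :
  pure_mono f -> tensor_map X f t \in powm m n (tensor X B) ->
  t \in powm m n (tensor X A).
Proof.
move=> f_pure; pose p := quotm_proj (powm m n X).
have [L LE] := bilinear_lift (bilinear_comp p idfun (@bilinear_tmul R _ B)).
have [s ->] := tensor_sumP t; rewrite tensor_map_sum => /(powm_map L).
move=> /(powm_tensor_annl (@powm_quot_ann X n)) Lf0.
apply: (tensor_right_exact (p := p) (q := idfun))
  => [x|y|x y /quotm_proj0 xn|x y y0|].
- exact: quotm_surj.
- by exists y.
- exact: (powm_map (linear_of (@tmul_linearl R X A y)) xn).
- by rewrite (y0 : y = 0) tmul0r rpred0.
apply: (f_pure (quotm (powm m n X))); rewrite linear0 tensor_map_sum.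
by rewrite -[RHS]Lf0 linear_sum; apply: eq_bigr => u _; rewrite LE.
Qed.

Lemma tensor_adic_powm (X M : lmodType R) (t : tensor X M) :
  tensor_map X (@adic_map R m M) t = 0 ->
  forall n, (1 <= n)%N -> t \in powm m n (tensor X M).
Proof.
move=> t0 [//|k] _; apply/tensor_quot_powm.
pose ev := prodm_eval (fun k => quotm (powm m k.+1 M)) k.
rewrite -(tensor_map_comp (f := @adic_map R m M) (g := ev)) //.
by rewrite t0 linear0.
Qed.

End AdicFiltration.

(** * Total separation and purity in the adic product *)

Section Equivalences.
Variables (R : comNzRingType) (m : ideal R).
Hypothesis R_noetherian : noetherian R.

Lemma tensor_gensP (X M : lmodType R) k (xs : 'I_k -> X) :
  (forall x, exists c : 'I_k -> R, x = \sum_i c i *: xs i) ->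
  forall t : tensor X M, exists n : 'I_k -> M, t = \sum_i tmul (xs i) (n i).
Proof.
move=> /choice[c cE] t; have [s ->] := tensor_sumP t.
exists (fun i => \sum_(u <- s) c u.1 i *: u.2).
under [RHS]eq_bigr do rewrite tmul_sumr.
rewrite exchange_big /=; apply: eq_bigr => u _.
rewrite [in LHS](cE u.1) tmul_suml; apply: eq_bigr => i _.
by rewrite tmulZl tmulZr.
Qed.

(** The finitely many unknowns y_j can be chosen in each factor M/m^n M
    separately, which is why X (x) prod M/m^n M embeds in the product of the
    X (x) M/m^n M. *)
Lemma pure_adic_totally_separated (M : lmodType R) :
  pure_mono (@adic_map R m M) -> totally_separated m M.
Proof.
move=> M_pure X /(fin_presentation R_noetherian).
move=> [k [xs [l [a [gen rel vanish]]]]] t tn.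
apply: (M_pure X); rewrite linear0.
have [n tE] := tensor_gensP gen t; rewrite tE tensor_map_sum.
have adic_solve : forall r, exists y : 'I_l -> quotm (powm m r.+1 M),
    forall i, adic_map m (n i) r = \sum_j a j i *: y j.
  move=> r; apply: vanish; rewrite -tensor_map_sum -tE.
  exact/tensor_quot_powm/tn.
pose z j : adic_prod m M := fun r => sval (cid (adic_solve r)) j.
have zE i : adic_map m (n i) = \sum_j a j i *: z j.
  apply: functional_extensionality_dep => r; rewrite prodm_sumE.
  exact: (svalP (cid (adic_solve r))).
under eq_bigr do rewrite /= zE tmul_sumr.
rewrite exchange_big big1 // => j _ /=.
under eq_bigr do rewrite tmulZr -tmulZl.
by rewrite -tmul_suml rel tmul0l.
Qed.

Lemma totally_separated_pure_adic (M : lmodType R) :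
  totally_separated m M -> pure_mono (@adic_map R m M).
Proof.
move=> M_sep; apply: pure_mono_fg => X X_fg t t0.
by apply: (M_sep X X_fg) => n n1; exact: tensor_adic_powm.
Qed.

Lemma pure_totally_separated (A B : lmodType R) (f : {linear A -> B}) :
  pure_mono f -> totally_separated m B -> totally_separated m A.
Proof.
move=> f_pure B_sep X X_fg t tn; apply: (f_pure X); rewrite linear0.
by apply: (B_sep X X_fg) => n n1; apply: powm_map; exact: tn.
Qed.

(** * Separated pure-injective modules are totally separated *)

(** The generators g and their number serve for every module V, so that
    decompositions of the terms of a sequence have the same length and
    assemble into a decomposition of the sequence. *)
Lemma ideal_pow_gens n : exists (k : nat) (g : 'I_k -> R),
  (forall i, g i \in ideal_pow m n) /\
  forall (V : lmodType R) (x : V), x \in powm m n V ->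
    exists y : 'I_k -> V, x = \sum_i g i *: y i.
Proof.
have [s sE] := R_noetherian (ideal_pow m n).
exists (size s), (tnth (in_tuple s)); split=> [i|V x].
  by rewrite sE; apply: mem_spanm; exact: mem_tnth.
pose P (x : V) := exists y : 'I_(size s) -> V,
  x = \sum_i (tnth (in_tuple s) i : R) *: y i.
have P0 : P 0 by exists (fun=> 0); rewrite big1 // => i _; rewrite scaler0.
have PD b u v : P u -> P v -> P (b *: u + v).
  move=> [y ->] [z ->]; exists (fun i => b *: y i + z i).
  rewrite scaler_sumr -big_split; apply: eq_bigr => i _.
  by rewrite scalerDr !scalerA mulrC.
move=> xV; apply/(mem_submodule_of P0 PD); apply: powm_min xV => b v.
rewrite sE => /span_seqP[c ->]; apply/mem_submodule_of.
exists (fun i => c i *: v); rewrite scaler_suml; apply: eq_bigr => i _.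
by rewrite scalerA mulrC.
Qed.

Section ReducedPower.
Variable N : lmodType R.

Definition eventually0 (c : prodm (fun _ : nat => N)) :=
  exists n0, forall n, (n0 <= n)%N -> c n = 0.
Fact eventually0_0 : eventually0 0.
Proof. by exists 0%N. Qed.
Fact eventually0_D a u v :
  eventually0 u -> eventually0 v -> eventually0 (a *: u + v).
Proof.
case=> p up [q vq]; exists (maxn p q) => n; rewrite geq_max => /andP[pn qn].
have -> : (a *: u + v) n = a *: u n + v n by [].
by rewrite up ?vq // scaler0 addr0.
Qed.
Definition fin_support := submodule_of eventually0_0 eventually0_D.

Definition red_power : lmodType R := quotm fin_support.
Fact diag_linear :
  linear (fun x => quotm_proj fin_support (fun=> x) : red_power).
Proof. by move=> a x y; rewrite -linearP. Qed.
Definition diag := linear_of diag_linear.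

(** If t dies in X (x) red_power, then its constant sequence is a finite sum of
    tensors with finitely supported sequences, hence is 0 at large indices,
    where its value is t. *)
Lemma pure_diag : pure_mono diag.
Proof.
apply: pure_mono_fg => X _ t; have [s ->] := tensor_sumP t.
pose ev n := prodm_eval (fun _ : nat => N) n.
pose P (t : tensor X (prodm (fun _ : nat => N))) :=
  exists n0, forall n, (n0 <= n)%N -> tensor_map X (ev n) t = 0.
have P0 : P 0 by exists 0%N => n _; rewrite linear0.
have PD a u v : P u -> P v -> P (a *: u + v).
  case=> p up [q vq]; exists (maxn p q) => n; rewrite geq_max => /andP[pn qn].
  by rewrite linearP /= up ?vq // scaler0 addr0.
rewrite tensor_map_sum => sum0.
have /mem_submodule_of[n0 /(_ n0 (leqnn n0))] :
    \sum_(u <- s) tmul u.1 ((fun=> u.2) : prodm (fun _ : nat => N))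
      \in submodule_of P0 PD.
  apply: (tensor_right_exact (p := idfun) (q := quotm_proj fin_support)
    (y := fun u => (fun=> u.2) : prodm (fun=> N)) _ _ _ _ sum0)
    => [x|y|x y x0|x y].
  - by exists x.
  - exact: quotm_surj.
  - by rewrite (x0 : x = 0) tmul0l rpred0.
  - move=> /quotm_proj0/mem_submodule_of[n0 yn0].
    apply/mem_submodule_of; exists n0 => n le.
    by rewrite tensor_map_tmul /= yn0 // tmul0r.
by rewrite tensor_map_sum.
Qed.

(** The terms before index n do not count in the reduced power, and the others
    are combinations of the same generators of m^n. *)
Lemma red_power_powm n (c : prodm (fun _ : nat => N)) :
  (forall n', (n <= n')%N -> c n' \in powm m n N) ->
  quotm_proj fin_support c \in powm m n red_power.
Proof.
move=> cn; have [k [g [gI gP]]] := ideal_pow_gens n.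
have /choice[y yE] : forall n', exists y : 'I_k -> N,
    (n <= n')%N -> c n' = \sum_i g i *: y i.
  move=> n'; case: (leqP n n') => [/cn/gP[y ->]|_]; first by exists y.
  by exists (fun=> 0).
pose z i : prodm (fun _ : nat => N) := fun n' => y n' i.
have -> : quotm_proj fin_support c =
    quotm_proj fin_support (\sum_i g i *: z i).
  apply/quotm_proj_eq/mem_submodule_of; exists n => n' le.
  have -> : (c - \sum_i g i *: z i) n' =
      c n' - (\sum_i g i *: z i : prodm _) n' by [].
  by rewrite prodm_sumE yE // subrr.
by apply: powm_map; apply: rpred_sum => i _; exact: scale_powm.
Qed.

End ReducedPower.

(** Algebraic compactness: solutions modulo every m^n are glued into a solution
    by retracting the reduced power of N onto N. *)
Lemma pure_injective_totally_separated (N : lmodType R) :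
  pure_injective N -> separated m N -> totally_separated m N.
Proof.
move=> N_pi N_sep X /(fin_presentation R_noetherian).
move=> [k [xs [l [a [gen rel vanish]]]]] t tn.
have [rho rhoK] := N_pi _ _ _ (@pure_diag N) idfun.
have [n tE] := tensor_gensP gen t.
have /choice[y yE] : forall r, exists y : 'I_l -> N,
    forall i, n i - \sum_j a j i *: y j \in powm m r.+1 N.
  move=> r; have /tensor_quot_powm := tn r.+1 isT.
  rewrite tE tensor_map_sum => /vanish[y yE].
  have /choice[z zE] : forall j, exists z, quotm_proj (powm m r.+1 N) z = y j.
    by move=> j; exact: quotm_surj.
  exists z => i; apply/quotm_proj_eq; rewrite yE linear_sum.
  by apply: eq_bigr => j _; rewrite linearZ /= zE.
(* y r solves the system modulo m^(r+1); Y, the retraction of the class of    *)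
(* these solutions, plays the part of their limit.                            *)
pose Y j := rho (quotm_proj (fin_support N) (fun r => y r j)).
have nE i : n i = \sum_j a j i *: Y j.
  apply/eqP; rewrite -subr_eq0; apply/eqP/N_sep => -[//|r] _.
  pose cst : prodm (fun _ : nat => N) := fun=> n i.
  pose seqy j : prodm (fun _ : nat => N) := fun r => y r j.
  have -> : n i - \sum_j a j i *: Y j =
      rho (quotm_proj (fin_support N) (cst - \sum_j a j i *: seqy j)).
    rewrite !linearB /= !linear_sum -[n i in LHS](rhoK (n i)); congr (_ + _).
    by apply: eq_bigr => j _; rewrite !linearZ.
  apply/powm_map/red_power_powm => r' le.
  apply: (powm_le (leqW le)).
  have -> : (cst - \sum_j a j i *: seqy j) r' =
      n i - (\sum_j a j i *: seqy j : prodm _) r' by [].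
  by rewrite prodm_sumE; exact: yE.
rewrite tE; under eq_bigr do rewrite nE tmul_sumr.
rewrite exchange_big big1 // => j _ /=.
under eq_bigr do rewrite tmulZr -tmulZl.
by rewrite -tmul_suml rel tmul0l.
Qed.

End Equivalences.

(** * The pure-injective hull *)

Section Hull.
Variables (R : comNzRingType).

Lemma pure_mono_precomp (A A' B : lmodType R) (c : {linear A -> A'})
    (d : {linear A' -> A}) (f : {linear A -> B}) (g : {linear A' -> B}) :
  cancel c d -> (forall a, g (c a) = f a) -> pure_mono g -> pure_mono f.
Proof.
move=> cK gcE g_pure X t t'; rewrite -!(tensor_map_comp gcE) => /g_pure ctt'.
have dcE a : d (c a) = idfun a by exact: cK.
have := congr1 (tensor_map X d) ctt'.
by rewrite !(tensor_map_comp dcE) !tensor_map_id.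
Qed.

(** Translates between maps and the inclusions of submodules in which
    pure-essentiality is expressed. *)
Lemma pure_mono_range (A B : lmodType R) (f : {linear A -> B})
    (S : submodule B) :
  injective f -> S =i imagem f (fullm A) -> (pure_mono f <-> pure_submodule S).
Proof.
move=> f_inj SE.
have fS a : f a \in S by rewrite SE; apply/asboolP; exists a.
have /choice[d dK] : forall s : submod_type S, exists a, f a = val s.
  by move=> s; have := valP s; rewrite SE => /asboolP[a _ <-]; exists a.
pose c a : submod_type S := Sub (f a) (fS a).
have cE a : val (c a) = f a by exact: SubK.
have cL : linear c by move=> a u v; apply: val_inj; rewrite /= linearP.
have dL : linear d.
  by move=> a u v; apply: f_inj; rewrite linearP /= !dK linearP.
split.
  apply: (pure_mono_precomp (c := linear_of dL) (d := linear_of cL)) => [s|s].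
    by apply: val_inj; rewrite /= dK.
  exact: dK.
apply: (pure_mono_precomp (c := linear_of cL) (d := linear_of dL)) => [a|a] //.
by apply: f_inj; rewrite /= dK.
Qed.

Lemma hull_pure (M N : lmodType R) (i : {linear M -> N}) :
  pure_injective_hull i -> pure_mono i.
Proof. by case=> i_inj [i_pure _] _; exact/(pure_mono_range i_inj). Qed.

(** Pure-essentiality is applied to the intersection X of the m^n N; that X
    meets M trivially follows from the injectivity of M -> N/X. *)
Lemma hull_separated (m : ideal R) (M N : lmodType R) (i : {linear M -> N}) :
  pure_injective_hull i -> totally_separated m M -> separated m N.
Proof.
move=> hull M_sep; have i_pure := hull_pure hull.
pose P (x : N) := forall n, (1 <= n)%N -> x \in powm m n N.
have P0 : P 0 by move=> n _; rewrite rpred0.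
have PD a u v : P u -> P v -> P (a *: u + v).
  by move=> Pu Pv n n1; rewrite rpredD ?rpredZ ?Pu ?Pv.
pose X := submodule_of P0 PD.
pose f : {linear M -> _} := quotm_proj X \o i.
have f_pure : pure_mono f.
  apply: pure_mono_fg => Z Z_fg t ft0; apply: (M_sep Z Z_fg) => n n1.
  apply: (pure_powm i_pure); move: ft0; have [s ->] := tensor_sumP t.
  rewrite !tensor_map_sum.
  apply: (tensor_right_exact (p := idfun) (q := quotm_proj X))
    => [x|y|x y x0|x y].
  - by exists x.
  - exact: quotm_surj.
  - by rewrite (x0 : x = 0) tmul0l rpred0.
  - move=> /quotm_proj0/mem_submodule_of/(_ n n1) yn.
    exact: (powm_map (linear_of (@tmul_linearr R Z N x)) yn).
have f_inj := pure_mono_inj f_pure.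
case: hull => _ [_ ess] _ x xP; apply: (ess X); last exact/mem_submodule_of.
  move=> y yX /asboolP[a _ aE]; rewrite -aE.
  suff -> : a = 0 by rewrite linear0.
  by apply: f_inj; rewrite linear0 /=; apply/quotm_proj0; rewrite aE.
apply/(pure_mono_range f_inj) => // z; apply/asboolP/asboolP.
- move=> [_ /asboolP[s [_ [sX /asboolP[a _ <-] ->]]] <-]; exists a => //=.
  by apply/quotm_proj_eq; rewrite opprD addrCA subrr addr0 rpredN.
- move=> [a _ <-]; exists (i a) => //; apply/asboolP; exists 0, (i a).
  by split; rewrite ?rpred0 ?add0r //; apply/asboolP; exists a.
Qed.
End Hull.

Theorem lemma1 (R : comNzRingType) (m : ideal R)
    (R_noetherian : noetherian R) (R_local : local_ring m) (M : lmodType R) :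
  (totally_separated m M <-> pure_mono (@adic_map R m M)) /\
  (forall (N : lmodType R) (i : {linear M -> N}), pure_injective_hull i ->
     (totally_separated m M <-> separated m N)).
Proof.
split.
  split; [exact: totally_separated_pure_adic|].
  exact: pure_adic_totally_separated.
move=> N i hull; split; first exact: hull_separated hull.
move=> N_sep; apply: pure_totally_separated (hull_pure hull) _.
by case: hull => _ _ N_pi; exact: pure_injective_totally_separated.
Qed.
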